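(* Let $X$ be a Tychonoff space, $\mathcal I$ an ideal of compact subsets of $X$, $Y$ a non-trivial metrizable locally convex space, and let $E=C_{\mathcal I}(X,Y)$, $E=C^b_{\mathcal I}(X,Y)$ or $E=C^{rc}_{\mathcal I}(X,Y)$. Then the following assertions are equivalent: (i) $E$ is a Fréchet–Urysohn space; (ii) $E$ is a sequential space; (iii) $E$ is a $k$-space; (iv) $X$ has the property $\gamma_{\mathcal I}$; (v) $E^\lambda$ is Fréchet–Urysohn (respectively, sequential or a $k$-space) for some $\lambda\in(0,\omega]$; (vi) $E^\lambda$ is Fréchet–Urysohn (respectively, sequential or a $k$-space) for every $\lambda\in(0,\omega]$. (Each of the three versions of (v) and of (vi) is equivalent to the other conditions.)
   Context: An ideal of compact subsets of a topological space $X$ is a family $\mathcal I$ of compact subsets of $X$ with $\bigcup\mathcal I=X$ such that for all $A,B\in\mathcal I$ and every compact $K\subseteq X$ one has $A\cup B\in\mathcal I$ and $A\cap K\in\mathcal I$. $C_{\mathcal I}(X,Y)$ is the set $C(X,Y)$ of continuous functions $X\to Y$ with the $\mathcal I$-open topology, whose subbase consists of the sets $\{f: f(K)\subseteq U\}$, $K\in\mathcal I$, $U\subseteq Y$ open. $C^b_{\mathcal I}(X,Y)$ and $C^{rc}_{\mathcal I}(X,Y)$ are its subspaces consisting of those $f$ for which $f(X)$ is, respectively, a bounded or a relatively compact subset of $Y$. Locally convex spaces are over $\mathbb R$ or $\mathbb C$. Here $\lambda\in(0,\omega]$ means $\lambda$ is a nonzero natural number or $\lambda=\omega$; $E^\lambda$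 has the product topology. A family $\gamma$ of subsets of $X$ is an $\mathcal I$-cover if every $A\in\mathcal I$ is contained in some $U\in\gamma$. An $\mathcal I$-sequence is a sequence $\{C_n\}_{n\in\omega}$ (repetitions allowed) of subsets of $X$ such that for every $A\in\mathcal I$ there is $m$ with $A\subseteq C_n$ for all $n\ge m$. $X$ has the property $\gamma_{\mathcal I}$ if every open $\mathcal I$-cover of $X$ contains an $\mathcal I$-sequence (of its members). A space is Fréchet–Urysohn if whenever $a\in\overline A$ there is a sequence in $A$ converging to $a$; sequential if for each non-closed $A$ there is a sequence in $A$ converging to a point of $\overline A\setminus A$; a $k$-space if for each non-closed $A$ there is a compact $K$ such that $A\cap K$ is not closed in $K$. *)

(* Defs.v *)
From HB Require Import structures.
From mathcomp Require Import all_boot all_order all_algebra.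
From mathcomp Require Import all_classical all_reals all_analysis.
From mathcomp Require Export complex.

Set Implicit Arguments.
Unset Strict Implicit.
Unset Printing Implicit Defensive.

Import Order.TTheory GRing.Theory Num.Theory.
Import numFieldTopology.Exports.

Local Open Scope classical_set_scope.
Local Open Scope ring_scope.

Section general_topology.
Variable T : topologicalType.

(* T need not be Hausdorff in [completely_regular_space]. *)
Definition tychonoff_space : Prop :=
  completely_regular_space T /\ hausdorff_space T.

Definition metrizable (R : realType) : Prop :=
  exists d : T -> T -> R,
    [/\ forall x y, 0 <= d x y,
        forall x y, d x y = 0 <-> x = y,
        forall x y, d x y = d y x,
        forall x y z, d x z <= d x y + d y z
      & forall (x : T) (A : set T),
          nbhs x A <-> exists2 e : R, 0 < e & [set y | d x y < e] `<=` A].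

Definition frechet_urysohn : Prop :=
  forall (A : set T) (a : T), closure A a ->
    exists2 u : nat -> T, (forall n, A (u n)) & u @ \oo --> a.

Definition sequential_space : Prop :=
  forall A : set T, ~ closed A ->
    exists (u : nat -> T) (a : T),
      [/\ forall n, A (u n), u @ \oo --> a & (closure A `\` A) a].

Definition closed_in (K B : set T) : Prop :=
  exists2 F : set T, closed F & B = F `&` K.

Definition k_space : Prop :=
  forall A : set T, ~ closed A ->
    exists2 K : set T, compact K & ~ closed_in K (A `&` K).

End general_topology.

(* Exponents in [0, omega]: [Some n] is the natural number n and [None] is
   omega, so a nonzero exponent is one different from [Some 0]. *)
Definition exponent := option nat.

Definition exponent_index (lam : exponent) : Type :=
  if lam is Some n then 'I_n else nat.

Definition power_space (E : topologicalType) (lam : exponent) :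
    topologicalType :=
  {ptws exponent_index lam -> E}.

Section ideals_of_compact_sets.
Variable X : topologicalType.

(* Nonemptiness of the family follows from the covering condition, except when
   X is empty, where it only excludes the empty family. *)
Definition compact_ideal (I : set (set X)) : Prop :=
  [/\ I !=set0,
      I `<=` compact,
      \bigcup_(A in I) A = setT,
      (forall A B, I A -> I B -> I (A `|` B))
    & (forall A K, I A -> compact K -> I (A `&` K))].

Variable I : set (set X).

Definition ideal_cover (gamma : set (set X)) : Prop :=
  forall A, I A -> exists2 U, gamma U & A `<=` U.

Definition ideal_sequence (C : nat -> set X) : Prop :=
  forall A, I A -> exists m, forall n, (m <= n)%N -> A `<=` C n.

Definition gamma_property : Prop :=
  forall gamma : set (set X), gamma `<=` open -> ideal_cover gamma ->
    exists2 C : nat -> set X, (forall n, gamma (C n)) & ideal_sequence C.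

End ideals_of_compact_sets.

(* The index I only selects the topology. *)
Definition ideal_open {X Y : topologicalType} (I : set (set X)) : Type :=
  continuousType X Y.
Arguments ideal_open : clear implicits.

Section ideal_open_topology.
Variables (X Y : topologicalType) (I : set (set X)).

HB.instance Definition _ := Choice.on (ideal_open X Y I).

HB.instance Definition _ :=
  isSubBaseTopological.Build (ideal_open X Y I)
    [set KU : set X * set Y | I KU.1 /\ open KU.2]
    (fun KU => [set f : ideal_open X Y I |
                 (f : continuousType X Y) @` KU.1 `<=` KU.2]).

End ideal_open_topology.

(* Bounded in the linear-topological sense, not with respect to a metric.  An
   inequality [0 < s] or [s < t] over R[i] forces s and t to be real. *)
Definition tvs_bounded {K : numFieldType} {Y : tvsType K} (B : set Y) : Prop :=
  forall U : set Y, nbhs 0 U ->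
    exists2 s : K, 0 < s & forall t : K, s < t -> B `<=` [set t *: y | y in U].

Section function_spaces.
Variables (X : topologicalType) (I : set (set X)).
Variables (K : numFieldType) (Y : tvsType K).

Definition C_ : topologicalType := ideal_open X Y I.

Definition Cb : topologicalType :=
  [set f : C_ | tvs_bounded (range (f : continuousType X Y))].

Definition Crc : topologicalType :=
  [set f : C_ | compact (closure (range (f : continuousType X Y)))].

End function_spaces.

(* Main.v *)
Require Import Defs.
From mathcomp Require Import all_boot all_order all_algebra finmap.
From mathcomp Require Import all_classical all_reals all_analysis.
From mathcomp Require Import lra.

(** Every Frechet-Urysohn space is sequential, every sequential space is a
    k-space, and a space is a retract of each of its nonzero powers, so the
    equivalences reduce to two implications about a function space E:
    - if X has the property gamma, then every countable power of E is
      Frechet-Urysohn ([gamma_frechet_urysohn_ptws]);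
    - if E is a k-space, then X has the property gamma
      ([k_space_gamma_property]).

    They are proved at once for the three function spaces, from two features
    that these share: the topology is uniform convergence on the members of the
    ideal I ([ideal_uniform]), and for A in I, an open set U containing A and a
    vector v there is a function in E equal to 0 on A and to v off U.

    First implication.  If a point a of a power is adherent to S, the sets where
    the coordinates of index < n of some f in S are 1/(n+1)-close to those of a
    form an I-cover, for each n.  Gamma yields one I-sequence drawn from these
    covers with n tending to infinity ([gamma_diagonal]), and the corresponding
    elements of S converge to a.

    Second implication.  Let the open sets V n increase to Y, with y n outside V
    n.  A compact set of functions maps each member of I into a single V n.
    Hence closed sets B n of functions that leave V n at suitable places tend to
    be compact-finite, each compact set meeting only finitely many of them; when
    they are, their union is closed in the k-space E
    ([k_space_compact_finite_union]).  For a countable open I-cover (C n) by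
    proper subsets, let B n consist of the functions that avoid V n off C n.
    The constant 0 is adherent to the union of the B n without belonging to it,
    so some compact set meets infinitely many B n, and the corresponding C n
    form an I-sequence ([countable_cover_gamma]).

    It remains to extract a countable I-cover from any open I-cover, for which
    countable tightness of E suffices ([k_space_countably_tight]).  Otherwise
    some compact K, some g in K and some set D closed under closures of
    countable subsets satisfy: g is adherent to D and K, but not in D.  A
    maximal family of pairs (f, A), with f in D and K and A in I, such that of
    any two members one function is close to g on the set of the other while the
    other function is far from g on the set of the first, is then uncountable.
    Taking limits of both the functions and the sets along an ultrafilter shows
    that the sets of such a family cannot accumulate at a member of I
    ([split_family_sparse]).  But in a k-space E, such a family of sets is
    countable: for an uncountable one, the functions that stay in V n on at most
    n of the sets form closed sets of the kind considered above, whose union has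
    0 in its closure without containing it ([k_space_sparse_countable]). *)

Set Implicit Arguments.
Unset Strict Implicit.
Unset Printing Implicit Defensive.

Import Order.TTheory GRing.Theory Num.Theory.
Import numFieldTopology.Exports.

Local Open Scope classical_set_scope.
Local Open Scope ring_scope.

(** * Sequential spaces, k-spaces and retracts *)

Lemma frechet_urysohn_sequential (T : topologicalType) :
  frechet_urysohn T -> sequential_space T.
Proof.
move=> FU A nA.
have [a [cla nAa]] : exists a, closure A a /\ ~ A a.
  apply: contrapT => h; apply: nA => a cla; apply: contrapT => nAa.
  by apply: h; exists a.
have [u Au ua] := FU A a cla.
by exists u, a.
Qed.

Lemma compact_cvg_range (T : topologicalType) (u : nat -> T) (a : T) :
  u @ \oo --> a -> compact (a |` range u).
Proof.
move=> ua; apply/compact_near_coveringP => J F P FF cov.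
have [[N S] [/= aN FS] NS] := cov a (or_introl erefl).
have [m _ mN] := ua N aN.
have fin : \forall i \near F, forall k, (k < m)%N -> P i (u k).
  elim: m {mN} => [|m IH]; first exact: nearW.
  have um : range u (u m) by exists m.
  have [[N' S'] [/= umN FS'] NS'] := cov (u m) (or_intror um).
  near=> i => k; rewrite ltnS leq_eqVlt => /orP[/eqP ->|km].
    apply: (NS' (u m, i)); split => /=; first exact: nbhs_singleton.
    by near: i.
  by move: k km; near: i.
near=> i => x [->|[k _ <-]].
  apply: (NS (a, i)); split => /=; first exact: nbhs_singleton.
  by near: i.
have [km|mk] := ltnP k m.
  by move: k {x} km; near: i.
apply: (NS (u k, i)); split => /=; first exact: mN.
by near: i.
Unshelve. all: by end_near. Qed.

Lemma sequential_k_space (T : topologicalType) :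
  sequential_space T -> k_space T.
Proof.
move=> sq A nA; have [u [a [Au ua [_ nAa]]]] := sq A nA.
exists (a |` range u); first exact: compact_cvg_range.
move=> [F clF AF]; apply: nAa.
have uF n : F (u n).
  have [] // : (F `&` (a |` range u)) (u n).
  by rewrite -AF; split=> //; right; exists n.
have Fa : F a.
  apply: clF => B /ua [m _ mB]; exists (u m); split=> //.
  by apply: mB => /=.
have [] // : (A `&` (a |` range u)) a.
by rewrite AF; split=> //; left.
Qed.

Section retracts.
Context {T S : topologicalType} (p : T -> S) (s : S -> T).
Hypotheses (cp : continuous p) (cs : continuous s) (ps : cancel s p).

Lemma retract_frechet_urysohn : frechet_urysohn T -> frechet_urysohn S.
Proof.
move=> FU A a cla.
have [|u Au ua] := FU (s @` A) (s a).
  move=> B /cs /cla [x [Ax Bx]].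
  by exists (s x); split => //; exists x.
exists (p \o u) => [n|].
  by have [x Ax /= <-] := Au n; rewrite ps.
by rewrite -[a]ps; apply: continuous_cvg => //; exact: cp.
Qed.

Lemma retract_k_space : k_space T -> k_space S.
Proof.
move=> kT A nA.
have [|K cK nK] := kT (p @^-1` A).
  move=> clpA; apply: nA.
  have -> : A = s @^-1` (p @^-1` A) by apply/seteqP; split=> x /=; rewrite ps.
  by apply: closed_comp clpA => x _; exact: cs.
exists (p @` K).
  by apply: continuous_compact => //; apply: continuous_subspaceT.
move=> [F clF AF]; apply: nK; exists (p @^-1` F).
  by apply: closed_comp clF => x _; exact: cp.
apply/seteqP; split=> x /= [Px Kx]; split=> //.
  have : (A `&` (p @` K)) (p x) by split=> //; exists x.
  by rewrite AF => -[].
have : (F `&` (p @` K)) (p x) by split=> //; exists x.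
by rewrite -AF => -[].
Qed.

End retracts.

(** The near-covering form of compactness along the filter of large integers
    replaces the extraction of a finite subcover. *)
Lemma compact_nondecreasing_cover (T : topologicalType) (K : set T)
    (O : nat -> set T) :
  compact K -> (forall n m, (n <= m)%N -> O n `<=` O m) ->
  (forall x, K x -> exists n, nbhs x (O n)) -> exists n, K `<=` O n.
Proof.
move=> /compact_near_coveringP cK mono cov.
have [|N _ KN] := cK nat \oo (fun n x => O n x) _.
  move=> x /cov[n xn]; exists (O n, [set m | (n <= m)%N]) => /=.
    by split=> //; exists n.
  by move=> [y m] /= [Ony nm]; exact: mono Ony.
by exists N; apply: (KN N) => /=.
Qed.

(** On each compact set, the union reduces to a finite one. *)
Lemma k_space_compact_finite_union (T : topologicalType) (B : nat -> set T) :
  k_space T -> (forall n, closed (B n)) ->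
  (forall K, compact K ->
     exists m, forall n, (m <= n)%N -> K `&` B n = set0) ->
  closed (\bigcup_n B n).
Proof.
move=> kT cB finB; apply: contrapT => /kT [K cK]; apply.
have [m mK] := finB K cK.
exists (\bigcup_(n in [set n | (n < m)%N]) B n).
  by apply: closed_bigcup => //; exact: finite_II.
apply/seteqP; split=> x [[n nm Bx] Kx]; split=> //; exists n => //=.
by rewrite ltnNge; apply/negP => /mK /seteqP[/(_ x)] + _; apply.
Qed.

(** * Countable sets *)

Lemma countable_image (T T' : Type) (f : T -> T') (S : set T) :
  countable S -> countable (f @` S).
Proof. by apply: sub_countable; exact: card_image_le. Qed.

Lemma countable_setU1 (T : Type) (a : T) (S : set T) :
  countable S -> countable (a |` S).
Proof.
move=> cS.
have -> : a |` S = \bigcup_(b in [set: bool]) (if b then [set a] else S).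
  apply/seteqP; split=> [x [xa|Sx]|x [[] _]]; [by exists true|by exists false|
    by left|by right].
by apply: bigcup_countable => // -[] _; first exact: countable1.
Qed.

Lemma countable_enumeration (T : Type) (S : set T) :
  countable S -> S !=set0 ->
  exists u : nat -> T, (forall n, S (u n)) /\ S `<=` range u.
Proof.
move=> /countable_injP[c cinj] [s0 Ss0].
have /choice[u uE] : forall n, exists t, S t /\
    forall s, S s -> c s = n -> t = s.
  move=> n; have [[s [Ss sn]]|nos] := pselect (exists s, S s /\ c s = n).
    exists s; split=> // t St tn.
    by apply: cinj; rewrite ?inE// sn.
  by exists s0; split=> // t St tn; exfalso; apply: nos; exists t.
exists u; split=> [n|s Ss]; first by have [] := uE n.
by exists (c s) => //; have [_] := uE (c s); apply.
Qed.

(** For a countable index set, the n-th stage imposes only the conditions whose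
    code is < n; these are finitely many, hence simultaneously near. *)
Lemma near_code_lt (J T : Type) (C : set J) (c : J -> nat) (F : set_system T)
    (P : J -> T -> Prop) n : Filter F -> {in C &, injective c} ->
  (forall i, C i -> (c i < n)%N -> \forall x \near F, P i x) ->
  \forall x \near F, forall i, C i -> (c i < n)%N -> P i x.
Proof.
move=> FF ci; elim: n => [|n IH] h; first exact: nearW.
have {}IH := IH (fun i Ci ni => h i Ci (ltnW ni)).
have hn : \forall x \near F, forall i, C i -> c i = n -> P i x.
  have [[i [Ci iE]]|noi] := pselect (exists i, C i /\ c i = n).
    apply: filterS (h i Ci _) => [x Px j Cj jE|]; last by rewrite iE.
    by rewrite -(ci i j (mem_set Ci) (mem_set Cj) (etrans iE (esym jE))).
  by apply: nearW => x i Ci iE; exfalso; apply: noi; exists i.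
apply: filterS2 hn IH => x Pn Plt i Ci; rewrite ltnS leq_eqVlt.
by move=> /orP[/eqP/(Pn _ Ci)|/(Plt _ Ci)].
Qed.

(** * Compatible metrics *)

(** The property of d that [metrizable] asserts for some d. *)
Definition metric_of (R : realType) (T : topologicalType) (d : T -> T -> R) :=
  [/\ forall x y, 0 <= d x y,
      forall x y, d x y = 0 <-> x = y,
      forall x y, d x y = d y x,
      forall x y z, d x z <= d x y + d y z
    & forall (x : T) (A : set T),
        nbhs x A <-> exists2 e : R, 0 < e & [set y | d x y < e] `<=` A].

Section metric_of_theory.
Context (R : realType) (X Y : topologicalType) (d : Y -> Y -> R).
Hypothesis md : metric_of d.

Lemma metric_of_refl x : d x x = 0.
Proof. by case: md => _ h _ _ _; exact/h. Qed.

Lemma metric_of_sym x y : d x y = d y x.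
Proof. by case: md. Qed.

Lemma metric_of_triangle x y z : d x z <= d x y + d y z.
Proof. by case: md. Qed.

Lemma nbhs_metric_of x (A : set Y) :
  nbhs x A <-> exists2 e : R, 0 < e & [set y | d x y < e] `<=` A.
Proof. by case: md. Qed.

Lemma near_metric_of x (e : R) : 0 < e -> \forall y \near x, d x y < e.
Proof. by move=> e0; apply/nbhs_metric_of; exists e. Qed.

Lemma near_metric_of_comp (f : X -> Y) x (e : R) : continuous f -> 0 < e ->
  \forall x' \near x, d (f x) (f x') < e.
Proof. by move=> cf e0; exact: (cf x _ (near_metric_of (f x) e0)). Qed.

Lemma open_metric_of_lt (f g : X -> Y) (e : R) :
  continuous f -> continuous g -> open [set x | d (f x) (g x) < e].
Proof.
move=> cf cg; rewrite openE => x /= xe.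
have h0 : 0 < (e - d (f x) (g x)) / 2 by lra.
have nf := near_metric_of_comp x cf h0.
have ng := near_metric_of_comp x cg h0.
near=> y.
have fy : d (f x) (f y) < (e - d (f x) (g x)) / 2 by near: y.
have gy : d (g x) (g y) < (e - d (f x) (g x)) / 2 by near: y.
have := metric_of_triangle (f y) (f x) (g y).
have := metric_of_triangle (f x) (g x) (g y).
rewrite (metric_of_sym (f y) (f x)) /=; lra.
Unshelve. all: by end_near. Qed.

Lemma open_metric_of_gt (f g : X -> Y) (e : R) :
  continuous f -> continuous g -> open [set x | e < d (f x) (g x)].
Proof.
move=> cf cg; rewrite openE => x /= xe.
have h0 : 0 < (d (f x) (g x) - e) / 2 by lra.
have nf := near_metric_of_comp x cf h0.
have ng := near_metric_of_comp x cg h0.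
near=> y.
have fy : d (f x) (f y) < (d (f x) (g x) - e) / 2 by near: y.
have gy : d (g x) (g y) < (d (f x) (g x) - e) / 2 by near: y.
have := metric_of_triangle (f x) (f y) (g x).
have := metric_of_triangle (f y) (g y) (g x).
rewrite (metric_of_sym (g y) (g x)) /=; lra.
Unshelve. all: by end_near. Qed.

End metric_of_theory.

Lemma metric_of_hausdorff (R : realType) (Y : topologicalType)
  (d : Y -> Y -> R) : metric_of d -> hausdorff_space Y.
Proof.
move=> md p q pq; case: (md) => d0 dE _ _ _; apply/dE.
apply/eqP; rewrite eq_le d0 andbT leNgt; apply/negP => dpq.
have h0 : 0 < d p q / 2 by lra.
have [r [/= pr qr]] := pq _ _ (near_metric_of md p h0) (near_metric_of md q h0).
have := metric_of_triangle md p r q.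
by rewrite (metric_of_sym md r q) => ?; lra.
Qed.

(** A compact graph inside an open set keeps a uniform vertical distance from
    the complement; this turns conditions of the form f(A) in W into conditions
    on the distance between functions. *)
Lemma compact_graph_margin (R : realType) (X Y : topologicalType)
    (d : Y -> Y -> R) (A : set X) (h : X -> Y) (G : set (X * Y)) :
  metric_of d -> compact A -> continuous h -> open G ->
  (forall x, A x -> G (x, h x)) ->
  exists n, forall x z, A x -> d z (h x) < n.+1%:R^-1 -> G (x, z).
Proof.
move=> md cA ch oG AG.
pose O n := [set x | forall z, d z (h x) < n.+1%:R^-1 -> G (x, z)].
have [n m nm x Onx z zm|x Ax|n AO] := compact_nondecreasing_cover (O := O) cA.
- by apply: Onx; apply: lt_le_trans zm _; rewrite lef_pV2 ?posrE// ler_nat.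
- move: oG; rewrite openE => /(_ _ (AG x Ax)) [[N1 N2] [/= N1x N2x] NG].
  have /(nbhs_metric_of md) [e e0 N2e] := N2x.
  have e20 : 0 < e / 2 by lra.
  have [m _ mE] := near_infty_natSinv_lt (PosNum e20).
  have {}mE : m.+1%:R^-1 < e / 2 := mE m (leqnn m).
  exists m.
  have := near_metric_of_comp md x ch e20.
  apply: filterS2 N1x => x' N1x' hx' z zm; apply: (NG (x', z)); split=> //=.
  have {}zm := lt_trans zm mE; apply: N2e => /=.
  have := metric_of_triangle md (h x) (h x') z.
  by rewrite (metric_of_sym md (h x') z); lra.
- by exists n => x z Ax; exact: (AO x Ax).
Qed.

(** * Spaces of functions with uniform convergence on an ideal *)

Lemma ptws_cvgP (J : Type) (E : topologicalType) (F : set_system {ptws J -> E})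
    (a : {ptws J -> E}) : Filter F ->
  (forall i, (fun f : {ptws J -> E} => f i) @ F --> a i) -> F --> a.
Proof.
move=> FF Fa; apply/cvg_sup => i B [_ [[C oC <-] Ca CB]].
apply: filterS CB _; apply: Fa; exact: open_nbhs_nbhs.
Qed.

(** What the equivalences need to know of the topology of a function space E,
    presented by its evaluation map.  For a subspace, ev is composed with the
    inclusion. *)
Definition ideal_uniform (R : realType) (X Y E : topologicalType)
    (I : set (set X)) (d : Y -> Y -> R) (ev : E -> X -> Y) :=
  (forall f, continuous (ev f)) /\
  forall f (S : set E), nbhs f S <->
    exists A (e : R), [/\ I A, 0 < e &
      forall g, (forall x, A x -> d (ev g x) (ev f x) < e) -> S g].

Lemma ideal_set1 (X : topologicalType) (I : set (set X)) (x : X) :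
  compact_ideal I -> I [set x].
Proof.
case=> _ _ cov _ capK.
have [A IA Ax] : (\bigcup_(A in I) A) x by rewrite cov.
have -> : [set x] = A `&` [set x] by apply/seteqP; split=> [y ->|y []].
by apply: capK => //; exact: compact_set1.
Qed.

Section function_space.
Context (R : realType) (X Y E : topologicalType) (I : set (set X)).
Context (d : Y -> Y -> R) (ev : E -> X -> Y).
Hypotheses (hI : compact_ideal I) (md : metric_of d).
Hypothesis uE : ideal_uniform I d ev.

Let cev f : continuous (ev f). Proof. by case: uE. Qed.

Let nbhs_evP f (S : set E) : nbhs f S <->
    exists A (e : R), [/\ I A, 0 < e &
      forall g, (forall x, A x -> d (ev g x) (ev f x) < e) -> S g].
Proof. by case: uE. Qed.

Let I_compact A : I A -> compact A. Proof. by case: hI => _ + _ _ _; apply. Qed.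

(** Openness of G is what makes this a neighborhood of h: the uniform radius is
    the margin of the graph of h over the compact set A. *)
Lemma nbhs_forall_ev (A : set X) (h : E) (G : set (X * Y)) : I A -> open G ->
  (forall x, A x -> G (x, ev h x)) ->
  nbhs h [set f | forall x, A x -> G (x, ev f x)].
Proof.
move=> IA oG AG.
have [n nG] := compact_graph_margin md (I_compact IA) (@cev h) oG AG.
by apply/nbhs_evP; exists A, n.+1%:R^-1; split=> // f fh x Ax; apply: nG; auto.
Qed.

Lemma nbhs_ev_subset (A : set X) (h : E) (W : set Y) : I A -> open W ->
  (forall x, A x -> W (ev h x)) ->
  nbhs h [set f | forall x, A x -> W (ev f x)].
Proof.
move=> IA oW; apply: (@nbhs_forall_ev A h [set p | W p.2]) => //.
by apply: open_comp => // x _; exact: cvg_snd.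
Qed.

Lemma nbhs_ev_lt (A : set X) (g h : E) (e : R) : I A ->
  (forall x, A x -> d (ev h x) (ev g x) < e) ->
  nbhs h [set f | forall x, A x -> d (ev f x) (ev g x) < e].
Proof.
move=> IA; apply: (@nbhs_forall_ev A h [set p | d p.2 (ev g p.1) < e]) => //.
apply: (open_metric_of_lt md) => p; first exact: cvg_snd.
by apply: continuous_comp; [exact: cvg_fst|exact: cev].
Qed.

Lemma nbhs_ev_gt (x : X) (g h : E) (e : R) : I [set x] ->
  e < d (ev h x) (ev g x) -> nbhs h [set f | e < d (ev f x) (ev g x)].
Proof.
move=> Ix xe.
have := @nbhs_forall_ev [set x] h [set p | e < d p.2 (ev g p.1)] Ix.
move=> /(_ _ _)/filterS; apply=> [f||y ->//]; first exact.
apply: (open_metric_of_gt md) => p; first exact: cvg_snd.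
by apply: continuous_comp; [exact: cvg_fst|exact: cev].
Qed.

(** * The property gamma and Frechet-Urysohn powers *)

Section gamma_to_frechet_urysohn.
Hypothesis T1 : forall x : X, closed [set x].

(** Gamma handles a single cover, so the covers of rank n are merged into one,
    the members of rank n losing a point p n.  The points are chosen, by gamma
    again, so that every member of I omits almost all of them: then the ranks
    along an I-sequence of the merged cover tend to infinity, since a fixed p n
    must eventually belong to its terms.  If X itself is in I, no such points
    exist, but then each cover has X as a member. *)
Lemma gamma_diagonal (T : Type) (U : nat -> T -> set X) :
  gamma_property I -> (forall n t, open (U n t)) ->
  (forall n A, I A -> exists t, A `<=` U n t) ->
  exists (k : nat -> nat) (t : nat -> T), k @ \oo --> \oo /\
    ideal_sequence I (fun n => U (k n) (t n)).
Proof.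
move=> gam oU cU.
have [IX|nIX] := pselect (I setT).
  have /choice[t Ut] : forall n, exists t, setT `<=` U n t.
    by move=> n; exact: cU.
  exists id, t; split; first exact: cvg_id.
  by move=> A _; exists 0%N => n _ x _; exact: Ut.
have [D DE0 seqD] : exists2 D : nat -> set X,
    (forall n, exists x, D n = ~` [set x]) & ideal_sequence I D.
  have [||D DE seqD] := gam [set D | exists x, D = ~` [set x]].
  - by move=> _ [x ->]; apply: closed_openC.
  - move=> A IA.
    have [x nAx] : exists x, ~ A x.
      apply/existsNP => AT; apply: nIX.
      by rewrite (_ : setT = A) //; apply/seteqP; split=> y _.
    by exists (~` [set x]); [exists x|move=> y Ay yx; apply: nAx; rewrite -yx].
  - by exists D.
have [p DE] := choice DE0.
pose gamma := [set W | exists n t, W = U n t `\ p n].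
have [||C gC seqC] := gam gamma.
- by move=> _ [n [t ->]]; apply: openI => //; apply: closed_openC.
- move=> A IA; have [n Dn] := seqD A IA; have [t At] := cU n A IA.
  exists (U n t `\ p n); first by exists n, t.
  by move=> x Ax; split; [exact: At|have := Dn n (leqnn n) x Ax; rewrite DE].
have [k kE] := choice gC; have [t CE] := choice kE.
exists k, t; split; last first.
  move=> A IA; have [m Cm] := seqC A IA; exists m => n mn x Ax.
  by have := Cm n mn x Ax; rewrite CE => -[].
move=> B [m _ mB].
have : forall j, \forall n \near \oo, k n <> j.
  move=> j; have [N CN] := seqC _ (ideal_set1 (p j) hI).
  exists N => // n /= Nn kn; have := CN n Nn (p j) erefl.
  by rewrite CE kn => -[_]; apply.
move=> kj.
have : \forall n \near \oo, forall j, (j < m)%N -> k n <> j.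
  elim: m {mB} => [|m IH]; first exact: nearW.
  apply: filterS2 (kj m) IH => n km klt j.
  by rewrite ltnS leq_eqVlt => /orP[/eqP ->|/klt].
apply: filterS => n km; apply: mB => /=.
by rewrite leqNgt; apply/negP => /km.
Qed.

Lemma gamma_frechet_urysohn_ptws (J : eqType) (c : J -> nat) :
  injective c -> gamma_property I -> frechet_urysohn {ptws J -> E}.
Proof.
move=> cinj gam S a cla.
have cinjT : {in [set: J] &, injective c} by move=> i j _ _; exact: cinj.
pose S' := {f : {ptws J -> E} | S f}.
pose U n (f : S') := [set x | forall i, setT i -> (c i < n)%N ->
  d (ev (sval f i) x) (ev (a i) x) < n.+1%:R^-1].
have [||k [t [koo seqt]]] := @gamma_diagonal S' U gam.
- move=> n f; rewrite openE => x Ux.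
  have := @near_code_lt J X setT c (nbhs x) (fun i x =>
    d (ev (sval f i) x) (ev (a i) x) < n.+1%:R^-1) n _ cinjT.
  apply=> i _ ni.
  have := open_metric_of_lt md n.+1%:R^-1 (@cev (sval f i)) (@cev (a i)).
  by rewrite openE => /(_ x (Ux i Logic.I ni)).
- move=> n A IA.
  have [|/= f [Sf Wf]] := cla [set f | forall i, setT i -> (c i < n)%N ->
      forall x, A x -> d (ev (f i) x) (ev (a i) x) < n.+1%:R^-1].
    have := @near_code_lt J {ptws J -> E} setT c (nbhs a) (fun i f =>
      forall x, A x -> d (ev (f i) x) (ev (a i) x) < n.+1%:R^-1) n _ cinjT.
    apply=> i _ ni.
    apply: (@proj_continuous J (fun=> E) i a
      [set g | forall x, A x -> d (ev g x) (ev (a i) x) < n.+1%:R^-1]).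
    by apply/nbhs_evP; exists A, n.+1%:R^-1; split; rewrite ?invr_gt0 ?ltr0n.
  by exists (exist _ f Sf) => x Ax i _ ni /=; exact: Wf.
exists (fun n => sval (t n)); first by move=> n; exact: (svalP (t n)).
apply: ptws_cvgP => i B /= /nbhs_evP[A [e [IA e0 AB]]].
have [m At] := seqt A IA.
have kbig : \forall n \near \oo, (c i < k n)%N.
  exact: (koo _ (nbhs_infty_gt (c i))).
have ksmall : \forall n \near \oo, (k n).+1%:R^-1 < e.
  exact: (koo _ (near_infty_natSinv_lt (PosNum e0))).
change (\forall n \near \oo, B (sval (t n) i)).
near=> n; apply: AB => x Ax.
have kne : (k n).+1%:R^-1 < e by near: n.
apply: lt_trans kne; apply: At => //; last by near: n.
by near: n; exists m.
Unshelve. all: by end_near. Qed.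

End gamma_to_frechet_urysohn.

(** * Families split by a point of a compact set of functions *)

(** A form of local finiteness of the family P, with the members of I in place
    of points and inclusion in place of meeting. *)
Definition ideal_sparse (J : Type) (C : set J) (P : J -> set X) :=
  forall A, I A -> exists W, [/\ open W, A `<=` W &
    finite_set [set j | C j /\ P j `<=` W]].

Definition far_on (g f : E) (e : R) (A : set X) :=
  exists2 x, A x & e <= d (ev f x) (ev g x).

(** The gap between e / 2 here and e in [far_on] survives passage to limits, so
    that a limit function cannot be both far and near on a set. *)
Definition near_on (g f : E) (e : R) (A : set X) :=
  forall x, A x -> d (ev f x) (ev g x) <= e / 2.

Lemma lt_or_far_on g f e A :
  (forall x, A x -> d (ev f x) (ev g x) < e) \/ far_on g f e A.
Proof.
have [fA|nfA] := pselect (far_on g f e A); first by right.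
left=> x Ax; rewrite ltNge; apply/negP => h; apply: nfA.
by exists x.
Qed.

Lemma near_on_or_gt g f e A :
  near_on g f e A \/ exists2 x, A x & e / 2 < d (ev f x) (ev g x).
Proof.
have [h|nh] := pselect (exists2 x, A x & e / 2 < d (ev f x) (ev g x)).
  by right.
left=> x Ax; rewrite leNgt; apply/negP => h; apply: nh.
by exists x.
Qed.

Lemma far_on_not_near_on g f e A :
  0 < e -> far_on g f e A -> near_on g f e A -> False.
Proof. by move=> e0 [x Ax ef] /(_ x Ax) fe; lra. Qed.

Section ultrafilter_limits.
Context (Q : Type) (U : set_system Q) (UU : UltraFilter U).
Context (z : Q -> E) (h g : E) (e : R).
Hypothesis zh : z @ U --> h.

Lemma far_on_limit B : I B -> U [set q | far_on g (z q) e B] -> far_on g h e B.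
Proof.
move=> IB UB; have [he|//] := lt_or_far_on g h e B.
have Uh : U [set q | forall x, B x -> d (ev (z q) x) (ev g x) < e].
  exact: (zh (nbhs_ev_lt IB he)).
have [q [[x Bx xe] /(_ x Bx)]] := filter_ex (filterI UB Uh).
by rewrite ltNge xe.
Qed.

Lemma near_on_limit B :
  I B -> U [set q | near_on g (z q) e B] -> near_on g h e B.
Proof.
move=> IB UB; have [//|[x Bx xe]] := near_on_or_gt g h e B.
have Ix : I [set x] by exact: (ideal_set1 _ hI).
have Uh : U [set q | e / 2 < d (ev (z q) x) (ev g x)].
  exact: (zh (nbhs_ev_gt Ix xe)).
have [q [/(_ x Bx) qe]] := filter_ex (filterI UB Uh).
by rewrite /= ltNge qe.
Qed.

End ultrafilter_limits.

Section ultrafilter_limit_set.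
Context (Q : Type) (U : set_system Q) (UU : UltraFilter U).
Context (P : Q -> set X) (A : set X) (g : E) (e : R).
Hypothesis IA : I A.
Hypothesis PA : forall W, open W -> A `<=` W -> U [set q | P q `<=` W].

(** The limit of the sets P q along U in the sense of the lower Vietoris
    topology; compactness of A provides the upper half, [limit_set_attracts]. *)
Definition limit_set : set X :=
  A `&` [set x | forall O, nbhs x O -> U [set q | P q `&` O !=set0]].

Lemma ideal_limit_set : I limit_set.
Proof.
case: hI => _ cI _ _ capI; rewrite /limit_set -[A]setIid -setIA.
apply: capI => //; apply: compact_closedI; first exact: cI.
move=> x clx O /nbhs_interior/clx[y [yU /= yO]]; exact: yU.
Qed.

(** A point of A outside the limit set has a neighborhood missed by U-most P q.
    Finitely many of these neighborhoods, with W, cover A; the finite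
    intersection is taken by working with small sets S of the ultrafilter. *)
Lemma limit_set_attracts W : open W -> limit_set `<=` W ->
  U [set q | P q `<=` W].
Proof.
move=> oW BW; have cA : compact A by case: hI => _ + _ _ _; exact.
pose Loc (S : set Q) (x : X) := nbhs x [set y | forall q, S q -> P q y -> W y].
have [S [US AS]] : exists S, U S /\ A `<=` Loc S.
  have /compact_near_coveringP/(_ _ (powerset_filter_from U) Loc _) := cA.
  move=> /(_ _)[x Ax|M [MU _ [S MS]] MA]; last first.
    by exists S; split; [exact: MU|exact: MA].
  have [xB|] := pselect (forall O, nbhs x O -> U [set q | P q `&` O !=set0]).
    have Wx : W x by apply: BW.
    exists (W, setT) => [/=|[y S] /= [Wy _]].
      by split; [exact: open_nbhs_nbhs|exact: filterT].
    by apply: filterS (open_nbhs_nbhs (conj oW Wy)) => y' Wy' q _ _.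
  move=> /existsNP [N /not_implyP [xO nU]].
  have {nU} UO : U [set q | ~ (P q `&` N !=set0)].
    by have [|//] := in_ultra_setVsetC [set q | P q `&` N !=set0] UU.
  exists (interior N, [set S | S `<=` [set q | ~ (P q `&` N !=set0)]]).
    by split=> /=; [exact: nbhs_interior|exact: small_set_sub].
  move=> [y S] /= [yO SO]; apply: filterS yO => y' Oy' q Sq Pq.
  by exfalso; apply: (SO _ Sq); exists y'.
pose G := interior [set y | forall q, S q -> P q y -> W y].
have UG : U [set q | P q `<=` G] by apply: PA => //; exact: open_interior.
apply: filterS2 US UG => q Sq PG y Py.
exact: (interior_subset (PG y Py) q Sq Py).
Qed.

Lemma far_on_limit_set f : U [set q | far_on g f e (P q)] ->
  far_on g f e limit_set.
Proof.
move=> Uf; have [fe|//] := lt_or_far_on g f e limit_set.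
have Ue := limit_set_attracts (open_metric_of_lt md e (@cev f) (@cev g)) fe.
have [q [[x Px xe] /(_ x Px)]] := filter_ex (filterI Uf Ue).
by rewrite /= ltNge xe.
Qed.

Lemma near_on_limit_set f : U [set q | near_on g f e (P q)] ->
  near_on g f e limit_set.
Proof.
move=> Uf; have [//|[x [Ax xU] xe]] := near_on_or_gt g f e limit_set.
have Ux : nbhs x [set y | e / 2 < d (ev f y) (ev g y)].
  have := open_metric_of_gt md (e / 2) (@cev f) (@cev g).
  by rewrite openE; apply.
have [q [fq [y [Py]]]] := filter_ex (filterI Uf (xU _ Ux)).
by rewrite /= ltNge (fq y Py).
Qed.

End ultrafilter_limit_set.

Lemma ultra_compact_cvg (Q : Type) (U : set_system Q) (UU : UltraFilter U)
    (z : Q -> E) (K : set E) : compact K -> U [set q | K (z q)] ->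
  exists h : E, z @ U --> h.
Proof.
move=> cK UK; have [h [Kh hU]] := cK (z @ U) _ UK.
exists h => N hN; have [//|UN] := in_ultra_setVsetC (z @^-1` N) UU.
by have [x []] := hU (~` N) N UN hN.
Qed.

(** If infinitely many sets of the family lie in each neighborhood of A, let
    them tend to a limit set B along a nonprincipal ultrafilter, and let the
    functions tend to h.  For each q, U-most r lie on the same side of q.  If,
    for most q, q comes before most r, then each such q is far on B, hence h is
    far on B; but h is the limit of the r, which are near on the set of q, so h
    is near on that set for most q, hence near on B.  If most q come after most
    r, the two conclusions are exchanged. *)
Lemma split_family_sparse (C : set (E * set X)) (K : set E) (g : E) (e : R) :
  compact K -> 0 < e ->
  (forall q, C q -> K q.1 /\ I q.2) ->
  (forall q r, C q -> C r -> q <> r ->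
     (far_on g q.1 e r.2 /\ near_on g r.1 e q.2) \/
     (far_on g r.1 e q.2 /\ near_on g q.1 e r.2)) ->
  ideal_sparse C snd.
Proof.
move=> cK e0 CKI Ctot A IA; apply: contrapT => noW.
(* The filter that expresses concentration of the family around A: up to
   finitely many indices, S contains those whose set lies in some W. *)
pose F := [set S : set (E * set X) | exists W, [/\ open W, A `<=` W &
  finite_set ([set q | C q /\ q.2 `<=` W] `\` S)]].
have PF : ProperFilter F.
  split.
    by move=> [W [oW AW]]; rewrite setD0 => finW; apply: noW; exists W.
  split.
  - by exists setT; rewrite setDT; split => //; exact: openT.
  - move=> S S' [W [oW AW finW]] [W' [oW' AW' finW']].
    exists (W `&` W'); split; [exact: openI|by move=> x Ax; split; auto|].
    have := conj finW finW'; rewrite -finite_setU; apply: sub_finite_set.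
    move=> q [[Cq qW] /not_andP[nS|nS']]; [left|right];
      by split=> //; split=> // x /qW[].
  - move=> S S' SS' [W [oW AW finW]]; exists W; split=> //.
    by apply: sub_finite_set finW => q [qW nS]; split=> // /SS'.
have [U [UU FU]] := ultraFilterLemma PF.
have UC : U C.
  apply: FU; exists setT; split; [exact: openT|by []|].
  by rewrite (_ : _ `\` _ = set0)//; apply/seteqP; split=> // q [[]].
have Une q : U [set r | r <> q].
  apply: FU; exists setT; split; [exact: openT|by []|].
  by apply: (@sub_finite_set _ _ [set q]) (finite_set1 q) => r [_ /contrapT].
have PA W : open W -> A `<=` W -> U [set q | q.2 `<=` W].
  move=> oW AW; have : F [set q | C q -> q.2 `<=` W].
    exists W; split=> //; rewrite (_ : _ `\` _ = set0)//.
    by apply/seteqP; split=> // q [[Cq qW]]; apply.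
  by move=> /FU UW; apply: filterS2 (UC) UW => q Cq; exact.
have [h zh] : exists h : E, fst @ U --> h.
  by apply: (ultra_compact_cvg UU cK); apply: filterS (UC) => q /CKI[].
pose B := limit_set U snd A.
have IB : I B by exact: ideal_limit_set.
have farB f : U [set q | far_on g f e q.2] -> far_on g f e B.
  exact: far_on_limit_set.
have nearB f : U [set q | near_on g f e q.2] -> near_on g f e B.
  exact: near_on_limit_set.
have farh A' : I A' -> U [set q | far_on g q.1 e A'] -> far_on g h e A'.
  exact: far_on_limit.
have nearh A' : I A' -> U [set q | near_on g q.1 e A'] -> near_on g h e A'.
  exact: near_on_limit.
pose before q r := far_on g q.1 e r.2 /\ near_on g r.1 e q.2.
have [UJ|UJ] := in_ultra_setVsetC [set q | U [set r | before q r]] UU.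
- apply: (@far_on_not_near_on g h e B) => //.
    apply: farh => //; apply: filterS UJ => q Uq; apply: farB.
    by apply: filterS Uq => r [].
  apply: nearB; apply: filterS2 (UC) UJ => q Cq Uq.
  apply: nearh; first by have [] := CKI q Cq.
  by apply: filterS Uq => r [].
- have {}UJ : U [set q | C q /\ U [set r | before r q]].
    apply: filterS2 (UC) UJ => q Cq nU; split=> //.
    have [//|UN] := in_ultra_setVsetC [set r | before q r] UU.
    apply: filterS2 (filterI UC (Une q)) UN => r [Cr rq] nqr.
    by have [|//] := Ctot q r Cq Cr (fun h => rq (esym h)).
  apply: (@far_on_not_near_on g h e B) => //.
    apply: farB; apply: filterS UJ => q [Cq Uq].
    apply: farh; first by have [] := CKI q Cq.
    by apply: filterS Uq => r [].
  apply: nearh => //; apply: filterS UJ => q [Cq Uq]; apply: nearB.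
  by apply: filterS Uq => r [].
Qed.

(** * Function spaces that are k-spaces *)

(** V is an exhaustion of Y by proper open subsets, y witnesses properness, and
    o is the value that bump functions take on the prescribed set. *)
Section k_space_to_gamma.
Context (V : nat -> set Y) (o : Y) (y : nat -> Y).
Hypotheses (oV : forall n, open (V n))
  (V_mono : forall n m, (n <= m)%N -> V n `<=` V m)
  (V_cover : forall v, exists n, V n v)
  (Vo : forall n, V n o) (Vy : forall n, ~ V n (y n)).
Hypothesis bump : forall A U v, I A -> open U -> A `<=` U ->
  exists f : E,
    (forall x, A x -> ev f x = o) /\ (forall x, ~ U x -> ev f x = v).
Hypothesis kE : k_space E.

Lemma exists_constant : exists f0 : E, forall x, ev f0 x = o.
Proof.
case: (hI) => -[A0 IA0] _ _ _ capI.
have I0 : I set0 by rewrite -(setI0 A0); apply: capI => //; exact: compact0.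
have [f [_ f0]] := bump o I0 (@open0 X) (@subset_refl _ set0).
by exists f => x; apply: f0.
Qed.

Lemma closure_bump (f0 : E) (S : set E) : (forall x, ev f0 x = o) ->
  (forall A, I A -> exists U v, [/\ open U, A `<=` U &
     forall f, (forall x, ~ U x -> ev f x = v) -> S f]) ->
  closure S f0.
Proof.
move=> f0E bS N /nbhs_evP[A [e [IA e0 AN]]].
have [U [v [oU AU vS]]] := bS A IA; have [f [fA fU]] := bump v IA oU AU.
exists f; split; first exact: vS.
by apply: AN => x Ax; rewrite fA// f0E (metric_of_refl md).
Qed.

Lemma compact_ev_bounded (K : set E) (A : set X) : compact K -> I A ->
  exists n, forall f x, K f -> A x -> V n (ev f x).
Proof.
move=> cK IA.
have [||n KV] := compact_nondecreasing_cover
    (O := fun n => [set f | forall x, A x -> V n (ev f x)]) cK.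
- by move=> n m nm f fn x Ax; apply: (V_mono nm); exact: fn.
- move=> f _.
  have [||n AV] := compact_nondecreasing_cover
    (O := fun n => ev f @^-1` V n) (I_compact IA).
  + by move=> n m nm x; exact: V_mono.
  + move=> x _; have [n Vn] := V_cover (ev f x); exists n.
    by apply: (cev (f := f)); exact: open_nbhs_nbhs.
  + by exists n; apply: nbhs_ev_subset.
- by exists n => f x Kf; exact: (KV f Kf).
Qed.

(** For uncountable C, a compact set of functions has, for some m, infinitely
    many indices on whose sets it takes values in V m, by the pigeonhole
    principle; hence it misses B n for n >= m.  The constant o is adherent to
    the union of the B n: a function equal to o on A and to y n off W can stay
    in V n only on the finitely many sets inside W.  It is in no B n, since C is
    infinite. *)
Lemma k_space_sparse_countable (J : choiceType) (C : set J) (P : J -> set X) :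
  (forall j, C j -> I (P j)) -> ideal_sparse C P -> countable C.
Proof.
move=> IP finP; apply: contrapT => ncC.
have [f0 f0E] := exists_constant.
pose N n (f : E) := [set j | C j /\ forall x, P j x -> V n (ev f x)].
pose B n := [set f : E | forall s : {fset J}, [set` s] `<=` N n f ->
  (#|` s| <= n)%N].
have clB : closed (\bigcup_n B n).
  apply: k_space_compact_finite_union => // [n|K cK].
    rewrite -openC openE => f /existsNP [s /not_implyP [sN /negP ns]].
    have fs : nbhs f (\bigcap_(j in [set` s])
        [set g | forall x, P j x -> V n (ev g x)]).
      apply: filter_bigI => j js; have [Cj fj] := sN j js.
      exact: (nbhs_ev_subset (IP j Cj)).
    apply: filterS fs => g gs /(_ s) gB; apply: (negP ns); apply: gB => j js.
    by split; [have [] := sN j js|exact: gs].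
  pose Cb m := [set j | C j /\ forall f x, K f -> P j x -> V m (ev f x)].
  have CE : C = \bigcup_m Cb m.
    apply/seteqP; split=> [j Cj|j [m _ []//]].
    by have [m jm] := compact_ev_bounded cK (IP j Cj); exists m.
  have [m infm] : exists m, infinite_set (Cb m).
    apply/existsNP => fin; apply: ncC; rewrite CE.
    apply: bigcup_countable => // m _; exact: finite_set_countable.
  exists m => n mn; apply/seteqP; split=> // f [Kf Bf].
  have [s sC ns] := infinite_set_fset n.+1 infm.
  have : (#|` s| <= n)%N.
    apply: Bf => j js; have [Cj jm] := sC j js.
    by split=> // x Px; apply: (V_mono mn); exact: jm.
  by rewrite leqNgt ns.
have [n _ Bf0] : (\bigcup_n B n) f0.
  apply: clB; apply: (closure_bump f0E) => A IA.
  have [W [oW AW finW]] := finP A IA.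
  have [s sE] := iffLR finite_fsetP finW.
  exists W, (y #|` s|); split=> // f fW.
  exists #|` s| => // s' s'N; apply: fsubset_leq_card.
  apply/fsubsetP => j /s'N[Cj jV].
  have : [set` s] j; last by [].
  rewrite -sE; split=> // x Px; apply: contrapT => nWx.
  by apply: (Vy (n := #|` s|)); rewrite -(fW x nWx); exact: jV.
have infC : infinite_set C by move=> /finite_set_countable.
have [s sC ns] := infinite_set_fset n.+1 infC.
have : (#|` s| <= n)%N.
  by apply: Bf0 => j js; split; [exact: sC|move=> x _; rewrite f0E].
by rewrite leqNgt ns.
Qed.

(** The family C is built by maximality.  Given a countable part of it, some
    basic neighborhood of g over a new set misses the functions already chosen,
    and countable compactness of D intersected with K gives a function there
    that is near g on all the sets already chosen and on the new one; so a
    maximal C is uncountable.  The radii 1/(k+1) are then made constant by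
    pigeonhole, and the resulting uncountable family of sets is sparse, which a
    k-space excludes. *)
Lemma k_space_countably_tight (D : set E) :
  (forall S, countable S -> S `<=` D -> closure S `<=` D) -> closed D.
Proof.
move=> cD; apply: contrapT => /kE [K cK nK].
pose Z := D `&` K.
have [g [Kg clg nDg]] : exists g, [/\ K g, closure Z g & ~ D g].
  apply: contrapT => nog; apply: nK; exists (closure Z).
    exact: closed_closure.
  apply/seteqP; split=> f [Df Kf]; split=> //.
    by apply: subset_closure.
  by apply: contrapT => nDf; apply: nog; exists f.
have exists_far (S : set E) : countable S -> S `<=` Z ->
    exists A k, I A /\ forall f, S f -> far_on g f k.+1%:R^-1 A.
  move=> cS SZ; have ncl : ~ closure S g.
    by move=> /(cD S cS (fun f Sf => (SZ f Sf).1)).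
  move: ncl => /existsNP [N /not_implyP [/nbhs_evP[A [e [IA e0 AN]]] nSN]].
  have [k _ ke] := near_infty_natSinv_lt (PosNum e0).
  exists A, k; split=> // f Sf.
  have [fe|//] := lt_or_far_on g f k.+1%:R^-1 A.
  exfalso; apply: nSN; exists f; split=> //; apply: AN => x Ax.
  exact: lt_trans (fe x Ax) (ke k (leqnn k)).
have exists_near (T : set (set X * nat)) :
    countable T -> (forall p, T p -> I p.1) ->
    exists2 z, Z z & forall p, T p -> near_on g z p.2.+1%:R^-1 p.1.
  move=> /countable_injP[c cinj] IT.
  have /choice[z zE] : forall n, exists z, Z z /\ forall p, T p ->
      (c p < n)%N -> near_on g z p.2.+1%:R^-1 p.1.
    move=> n.
    have [|z [Zz zn]] := clg [set z | forall p, T p -> (c p < n)%N ->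
        near_on g z p.2.+1%:R^-1 p.1]; last by exists z.
    have := @near_code_lt _ E T c (nbhs g)
      (fun p f => near_on g f p.2.+1%:R^-1 p.1) n _ cinj.
    apply=> p Tp _.
    have p0 : 0 < p.2.+1%:R^-1 / 2 :> R by rewrite divr_gt0// invr_gt0 ltr0n.
    apply/nbhs_evP; exists p.1, (p.2.+1%:R^-1 / 2); split=> //; first exact: IT.
    by move=> f fp x px; exact/ltW/fp.
  have [h [Kh hz]] : K `&` cluster (z @ \oo) !=set0.
    by apply: cK; exists 0%N => // n _; have [[]] := zE n.
  exists h; first split=> //.
    apply: (cD (range z)) => [|_ [n _ <-]|N hN].
    - exact: countable_image.
    - by have [[]] := zE n.
    - by apply: hz hN; exists 0%N => // n _; exists n.
  move=> p Tp; have [//|[x px xe]] := near_on_or_gt g h p.2.+1%:R^-1 p.1.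
  have Ix : I [set x] by exact: (ideal_set1 _ hI).
  have zlate : (z @ \oo) [set f | near_on g f p.2.+1%:R^-1 p.1].
    exists (c p).+1 => // n /= pn; have [_] := zE n; exact.
  have [f [fp]] := hz _ _ zlate (nbhs_ev_gt Ix xe).
  by rewrite /= ltNge (fp x px).
pose before (q r : E * (set X * nat)) :=
  far_on g q.1 r.2.2.+1%:R^-1 r.2.1 /\
  near_on g r.1 q.2.2.+1%:R^-1 q.2.1.
(* An element (f, (A, k)) stands for f and for the neighborhood of g of radius
   1/(k+1) over A. *)
pose chain (C : set (E * (set X * nat))) :=
  (forall q, C q -> Z q.1 /\ I q.2.1) /\
  forall q r, C q -> C r -> q <> r -> before q r \/ before r q.
have [F Fch Ftot|C [[CZ Ctot] Cmax]] := @Zorn_bigcup _ chain.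
  split=> [q [C FC Cq]|q r [C FC Cq] [C' FC' Cr]].
    by have [CZ _] := Fch C FC; exact: CZ.
  have [CC'|C'C] := Ftot C C' FC FC'.
    by have [_] := Fch C' FC'; apply=> //; exact: CC'.
  by have [_] := Fch C FC; apply=> //; exact: C'C.
have ncC : ~ countable C.
  move=> cC.
  have [|f [q Cq <-]|A [k [IA fA]]] := exists_far (fst @` C).
  - exact: countable_image.
  - by have [] := CZ q Cq.
  pose T := (A, k) |` (snd @` C).
  have [||z Zz zT] := exists_near T.
  - by apply: countable_setU1; exact: countable_image.
  - by move=> p [->//|[q Cq <-]]; have [] := CZ q Cq.
  (* The new pair comes last: z is near g on A too, so q cannot be in C, whose
     functions are far from g on A. *)
  pose q := (z, (A, k)).
  have Cbefore r : C r -> before r q.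
    move=> Cr; split; first by apply: fA; exists r.
    by apply: zT; right; exists r.
  apply: (Cmax (q |` C)).
    split; first by move=> r Cr; right.
    move=> /(_ q (or_introl erefl)) Cq.
    apply: (@far_on_not_near_on g z k.+1%:R^-1 A).
    - by rewrite invr_gt0 ltr0n.
    - by apply: fA; exists q.
    - by apply: (zT (A, k)); left.
  split=> [r [->//|/CZ//]|r r' [->|Cr] [->|Cr']] => //.
  - by move=> _; right; exact: Cbefore.
  - by move=> _; left; exact: Cbefore.
  - exact: Ctot.
have [k nck] : exists k, ~ countable [set q | C (q.1, (q.2, k))].
  apply/existsNP => ck; apply: ncC.
  have -> : C = \bigcup_k ((fun q => (q.1, (q.2, k))) @`
      [set q | C (q.1, (q.2, k))]).
    apply/seteqP; split=> [[z [A k]] Cq|q [k _ [p Cp <-]]//].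
    by exists k => //; exists (z, A).
  by apply: bigcup_countable => // k _; apply: countable_image.
apply: nck; apply: (k_space_sparse_countable (P := snd)).
  by move=> q /CZ[].
apply: (split_family_sparse (K := K) (g := g) (e := k.+1%:R^-1)) => //.
- by move=> q /CZ[[]].
- move=> q r Cq Cr qr.
  have [||] := Ctot _ _ Cq Cr; [|by left|by right].
  by case: q r qr {Cq Cr} => [z A] [z' A'] qr [zz AA]; apply: qr; rewrite zz AA.
Qed.

(** Countable tightness at the constant o, for the functions that leave V 0 off
    some member of the cover; the functions adherent to a countable set of these
    form a set to which [k_space_countably_tight] applies. *)
Lemma countable_subcover (gamma : set (set X)) :
  gamma `<=` open -> ideal_cover I gamma ->
  exists2 C : nat -> set X, (forall n, gamma (C n)) &
    ideal_cover I (range C).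
Proof.
move=> og cg; have [f0 f0E] := exists_constant.
pose D := [set f : E | exists2 U, gamma U & forall x, ~ U x -> ~ V 0 (ev f x)].
pose Dw := [set f | exists2 S, countable S /\ S `<=` D & closure S f].
have clDw : closed Dw.
  apply: k_space_countably_tight => S cS SD f clf.
  have /choice[H HE] : forall s, exists H, S s ->
      [/\ countable H, H `<=` D & closure H s].
    move=> s; have [Ss|nSs] := pselect (S s); last by exists set0.
    by have [H [cH HD] clH] := SD s Ss; exists H.
  exists (\bigcup_(s in S) H s).
    split; first by apply: bigcup_countable => // s /HE[].
    by move=> h [s /HE[_ HD _]]; exact: HD.
  move=> N /nbhs_interior/clf[s [Ss sN]].
  have [_ _ /(_ N sN) [h [Hh Nh]]] := HE s Ss.
  by exists h; split=> //; exists s.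
have [S [cS SD] clS] : Dw f0.
  apply: clDw; apply: (closure_bump f0E) => A IA; have [U gU AU] := cg A IA.
  exists U, (y 0); split=> [||f fU] //; first exact: og.
  exists [set f]; last exact: subset_closure.
  split; first exact: countable1.
  by move=> _ ->; exists U => // x Ux; rewrite fU//; exact: Vy.
have S0 : S !=set0 by have [f [Sf _]] := clS setT filterT; exists f.
have [u [Su uS]] := countable_enumeration cS S0.
have /choice[C CE] : forall n, exists U, gamma U /\
    forall x, ~ U x -> ~ V 0 (ev (u n) x).
  by move=> n; have [U] := SD _ (Su n); exists U.
exists C => [n|A IA]; first by have [] := CE n.
have [|f [/uS[n _ <-] fV]] := clS [set f | forall x, A x -> V 0 (ev f x)].
  by apply: nbhs_ev_subset => // x _; rewrite f0E.
exists (C n); first by exists n.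
move=> x Ax; apply: contrapT => nCx; have [_ /(_ x nCx)] := CE n; apply.
exact: fV.
Qed.

(** If no I-sequence exists, a compact set K meets F n for finitely many n only:
    when K takes values in V n on A, a function of K in F n forces A to be a
    subset of C n. *)
Lemma countable_cover_gamma (C : nat -> set X) :
  (forall n, open (C n)) -> ideal_cover I (range C) ->
  exists k : nat -> nat, ideal_sequence I (C \o k).
Proof.
move=> oC cC; have [f0 f0E] := exists_constant.
apply: contrapT => nok.
pose F n := [set f : E | forall x, ~ C n x -> ~ V n (ev f x)].
have clF : closed (\bigcup_n F n).
  apply: k_space_compact_finite_union => // [n|K cK].
    rewrite -openC openE => f /existsNP[x /not_implyP[nCx /contrapT Vx]].
    have Ix : I [set x] by exact: (ideal_set1 _ hI).
    have fx : nbhs f [set g | forall x', [set x] x' -> V n (ev g x')].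
      by apply: (nbhs_ev_subset Ix (oV n)) => x' ->.
    by apply: filterS fx => g /(_ x erefl) gV /(_ x nCx).
  apply: contrapT => nom; apply: nok.
  have /choice[k kE'] : forall m, exists n, (m <= n)%N /\ K `&` F n !=set0.
    move=> m; apply: contrapT => non; apply: nom; exists m => n mn.
    apply: contrapT => /eqP/set0P KF; apply: non; exists n; split=> //.
  exists k => A IA; have [m KV] := compact_ev_bounded cK IA.
  exists m => n mn x Ax; apply: contrapT => nCx.
  have [nk [f [Kf /(_ x nCx)]]] := kE' n; apply.
  by apply: (V_mono (leq_trans mn nk)); exact: KV.
have [n _ Ff0] : (\bigcup_n F n) f0.
  apply: clF; apply: (closure_bump f0E) => A IA.
  have [_ [n _ <-] AC] := cC A IA; exists (C n), (y n); split=> // f fC.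
  by exists n => // x nCx; rewrite fC//; exact: Vy.
(* The constant o belongs to F n only if C n is the whole space. *)
apply: nok; exists (fun=> n) => A IA; exists 0%N => m _ x _.
by apply: contrapT => /Ff0; rewrite f0E; apply.
Qed.

Lemma k_space_gamma_property : gamma_property I.
Proof.
move=> gamma og cg; have [C gC cC] := countable_subcover og cg.
have [k seqk] := countable_cover_gamma (fun n => og _ (gC n)) cC.
by exists (C \o k) => // n; exact: gC.
Qed.

End k_space_to_gamma.

End function_space.

(** * The ideal-open topology is uniform convergence on the ideal *)

Section ideal_open_uniform.
Context (R : realType) (X Y : topologicalType) (I : set (set X)).
Context (d : Y -> Y -> R).
Hypotheses (hI : compact_ideal I) (md : metric_of d).

Definition ev (f : ideal_open X Y I) : X -> Y := (f : continuousType X Y).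

Definition uniform_nbhs (f : ideal_open X Y I) :
    set_system (ideal_open X Y I) :=
  [set S | exists A (e : R), [/\ I A, 0 < e &
      forall g, (forall x, A x -> d (ev g x) (ev f x) < e) -> S g]].

Lemma continuous_ev f : continuous (ev f).
Proof. exact: (@cts_fun _ _ (f : continuousType X Y)). Qed.

Lemma uniform_nbhs_filter f : Filter (uniform_nbhs f).
Proof.
case: (hI) => -[A0 IA0] _ _ cupI _; split.
- by exists A0, 1; split.
- move=> S S' [A [e [IA e0 AS]]] [A' [e' [IA' e'0 AS']]].
  exists (A `|` A'), (Num.min e e'); split.
  + exact: cupI.
  + by rewrite lt_min e0.
  + move=> g gf; split; [apply: AS => x Ax|apply: AS' => x Ax].
      by have := gf x (or_introl Ax); rewrite lt_min => /andP[].
    by have := gf x (or_intror Ax); rewrite lt_min => /andP[].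
- move=> S S' SS' [A [e [IA e0 AS]]]; exists A, e; split=> // g gf.
  by apply: SS'; exact: AS.
Qed.

Lemma open_ideal_subbase (A : set X) (W : set Y) : I A -> open W ->
  open [set f : ideal_open X Y I | ev f @` A `<=` W].
Proof.
move=> IA oW; exists [set [set f : ideal_open X Y I | ev f @` A `<=` W]].
  move=> _ ->; exists [fset (A, W)]%fset.
    by move=> p /fset1P ->; rewrite inE.
  rewrite predeqE => f; split=> [h|h p /fset1P -> //].
  by apply: (h (A, W)); rewrite /= in_fset1.
rewrite predeqE => f; split=> [[_ ->]|] // h.
by exists [set f | ev f @` A `<=` W].
Qed.

(** A subbasic set contains a uniform neighborhood by [compact_graph_margin].
    Conversely, cover A by the compact pieces on which f stays e/4-close to f x;
    they belong to I because I contains the compact parts of its members, and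
    each gives a subbasic set of functions e-close to f on the piece. *)
Lemma ideal_open_uniform : ideal_uniform I d ev.
Proof.
split=> [|f S]; first exact: continuous_ev.
have cI A : I A -> compact A by case: hI => _ + _ _ _; apply.
split.
  rewrite nbhsE => -[_ [[B sB <-] [C BC Cf] sBS]].
  have FF := uniform_nbhs_filter f.
  suff : uniform_nbhs f C.
    by apply: (@filterS _ _ FF) => g Cg; apply: sBS; exists C.
  have /sB [L sL LC] := BC; rewrite -LC.
  apply: filter_bigI => -[A W] AWL.
  have := sL _ AWL; rewrite inE => -[/= IA oW].
  have fAW : ev f @` A `<=` W by move: Cf; rewrite -LC => /(_ _ AWL).
  have [||n nW] := @compact_graph_margin R X Y d A (ev f) [set p | W p.2]
      md (cI A IA) (@continuous_ev f).
  - by apply: open_comp => // x _; exact: cvg_snd.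
  - by move=> x Ax; apply: fAW; exists x.
  - exists A, n.+1%:R^-1; split=> // g gf _ [x Ax <-].
    by apply: (nW x) => //; exact: gf.
move=> [A [e [IA e0 AS]]].
suff : \forall g \near f, A `<=` [set x | d (ev g x) (ev f x) < e].
  by apply: filterS => g; exact: AS.
have /compact_near_coveringP/near_covering_withinP cA := cI A IA.
apply: (cA _ (nbhs f) (fun g x => d (ev g x) (ev f x) < e)) => x Ax.
have e40 : 0 < e / 4 by lra.
pose K := A `&` [set x' | d (ev f x) (ev f x') <= e / 4].
have IK : I K.
  case: hI => _ _ _ _ capI; rewrite /K -[A]setIid -setIA; apply: capI => //.
  apply: compact_closedI; first exact: cI.
  rewrite -openC (_ : ~` _ = [set x' | e / 4 < d (ev f x) (ev f x')]).
    apply: (open_metric_of_gt md); last exact: continuous_ev.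
    by move=> x'; exact: cvg_cst.
  by apply/seteqP; split=> x' /=; rewrite ltNge => /negP.
pose W := [set z | d (ev f x) z < e / 2].
have oW : open W.
  apply: (@open_metric_of_lt R Y Y d md (fun=> ev f x) id).
    by move=> x'; exact: cvg_cst.
  by move=> x'; exact: cvg_id.
have nW : nbhs f [set g : ideal_open X Y I | ev g @` K `<=` W].
  apply: open_nbhs_nbhs; split; first exact: open_ideal_subbase.
  by move=> _ [x' [Ax' /= fx'] <-]; rewrite /W /=; lra.
exists ([set x' | d (ev f x) (ev f x') < e / 4],
        [set g : ideal_open X Y I | ev g @` K `<=` W]).
  split=> //=; exact: (near_metric_of_comp md x (@continuous_ev f)).
move=> [x' g] /= [fx' gK] Ax'.
have : W (ev g x') by apply: gK; exists x' => //; split=> //; exact: ltW.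
rewrite /W /=.
have := metric_of_triangle md (ev g x') (ev f x) (ev f x').
by rewrite (metric_of_sym md (ev g x') (ev f x)); lra.
Qed.

Lemma subspace_uniform (P : set (ideal_open X Y I)) :
  ideal_uniform (E := P : topologicalType) I d (fun f => ev (set_val f)).
Proof.
split=> [f|f S]; first exact: continuous_ev.
have [_ uE] := ideal_open_uniform.
split.
  rewrite nbhsE => -[_ [[B oB <-] Bf] BS].
  have /uE[A [e [IA e0 AB]]] : nbhs (set_val f) B by apply: open_nbhs_nbhs.
  by exists A, e; split=> // g gf; apply: BS; exact: AB.
move=> [A [e [IA e0 AS]]].
apply: (@filterS _ _ _ (set_val @^-1` [set g | forall x, A x ->
  d (ev g x) (ev (set_val f) x) < e])) => //.
apply: (@initial_continuous P (ideal_open X Y I) set_val f).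
by apply/uE; exists A, e.
Qed.

End ideal_open_uniform.

(** * Bump functions with values in a locally convex space *)

(** Functions that are 1 off U and small near a given point of A are directed
    downwards under pointwise minimum, so compactness gives a single one that is
    < 1/2 on all of A; rescaling and truncating makes it 0 there. *)
Lemma compact_closed_separation (R : realType) (X : topologicalType)
    (A U : set X) :
  completely_regular_space X -> compact A -> open U -> A `<=` U ->
  exists h : X -> R, [/\ continuous h, forall x, 0 <= h x <= 1,
    forall x, A x -> h x = 0 & forall x, ~ U x -> h x = 1].
Proof.
move=> crX cA oU AU.
pose good (h : X -> R) := [/\ continuous h, forall x, 0 <= h x <= 1 &
  forall x, ~ U x -> h x = 1].
pose F := filter_from good (fun h => [set k | good k /\ forall x, k x <= h x]).
have FF : Filter F.
  apply: filter_from_filter.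
    exists (fun=> 1); split=> //; last by move=> x; rewrite ler01 lexx.
    by move=> x; exact: cvg_cst.
  move=> h k [ch h01 hU] [ck k01 kU]; exists (fun x => Num.min (h x) (k x)).
    split.
    - by move=> x; apply: (@continuous_min _ _ h k x (ch x) (ck x)).
    - move=> x; have := h01 x; have := k01 x.
      by rewrite le_min ge_min => /andP[-> ->] /andP[-> ->].
    - by move=> x nUx; rewrite hU// kU// minxx.
  move=> l [gl lhk]; split; split=> // x; have := lhk x;
    by rewrite le_min => /andP[].
have /compact_near_coveringP cA' := cA.
have [|h gh hA] := cA' _ F (fun k x => k x < 2^-1).
  move=> x Ax.
  have [|f [cf f01 fx fU]] := iffLR (@uniform_separatorP X R [set x] (~` U)) _.
    by apply: crX; [exact: open_closedC|apply; exact: AU].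
  have fx0 : f x = 0 by apply: fx; exists x.
  exists ([set x' | f x' < 2^-1], [set k | good k /\ forall x, k x <= f x]).
    split=> /=.
      have : open [set x' | f x' < 2^-1].
        apply: (@open_comp _ _ f [set y | y < 2^-1]); last exact: open_lt.
        by move=> y _; exact: cf.
      by rewrite openE; apply; rewrite /= fx0 invr_gt0.
    exists f => //; split=> //.
      move=> y; have : range f (f y) by exists y.
      by move=> /f01; rewrite /= in_itv.
    by move=> y nUy; apply: fU; exists y.
  by move=> [x' k] /= [fx' [_ kf]]; exact: le_lt_trans (kf x') fx'.
have [ch h01 hU] := gh.
exists (fun x => Num.max 0 (2 * h x - 1)); split.
- move=> x; apply: (@continuous_max _ _ (fun=> 0) (fun x => 2 * h x - 1) x).
    exact: cvg_cst.
  by apply: cvgB; [apply: cvgMl_tmp; exact: ch|exact: cvg_cst].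
- by move=> x; rewrite le_max lexx /= ge_max ler01 /=; have := h01 x; lra.
- move=> x Ax; apply/max_idPl.
  have := hA h (conj gh (fun x => lexx _)) x Ax; lra.
- move=> x nUx; rewrite hU// (_ : 2 * 1 - 1 = 1 :> R); last by lra.
  exact/max_idPr/ler01.
Qed.

(** Both choices of scalars are handled through an embedding of the reals that
    maps the unit interval into the unit ball. *)
Lemma real_scalars (R : realType) (K : numFieldType) :
  K = (R : numFieldType) \/ K = (R[i]%C : numFieldType) ->
  exists phi : R -> K, [/\ continuous (phi : R -> K^o), phi 0 = 0, phi 1 = 1,
    (forall n, phi n.+1%:R^-1 = n.+1%:R^-1) &
    forall t, 0 <= t <= 1 -> `|phi t| <= 1].
Proof.
case=> ->.
  exists id; split=> // [x|t /andP[t0 t1]]; first exact: cvg_id.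
  by rewrite ger0_norm.
exists (real_complex R); split=> //.
- move=> x; apply/(@cvgrPdist_lt _ R[i]%C^o) => /= e0' e0.
  pose e : R[i]%C := e0'.
  have eE : (complex.Re e)%:C%C = e by apply: RRe_real; exact: gtr0_real.
  have e'0 : 0 < complex.Re e by rewrite -ltcR eE.
  have : \forall t \near x, `|x - t| < complex.Re e.
    exact: (@cvgr_dist_lt _ R^o _ (nbhs x) _ id x (@cvg_id _ _) _ e'0).
  apply: filterS => t xt; rewrite -[e0']/e -eE -rmorphB /= normc_def /=.
  by rewrite expr0n addr0 sqrtr_sqr ltcR.
- by move=> n; rewrite fmorphV rmorph_nat.
- move=> t /andP[t0 t1]; rewrite normc_def /= expr0n addr0 sqrtr_sqr.
  by rewrite ger0_norm// lecR.
Qed.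

Section locally_convex_space.
Context (R : realType) (K : numFieldType) (Y : tvsType K).
Context (phi : R -> K).
Hypotheses (cphi : continuous (phi : R -> K^o)) (phi0 : phi 0 = 0)
  (phi1 : phi 1 = 1) (phiV : forall n, phi n.+1%:R^-1 = n.+1%:R^-1)
  (phi01 : forall t, 0 <= t <= 1 -> `|phi t| <= 1).
Hypothesis hausY : hausdorff_space Y.

Lemma scale_cvg (T : Type) (F : set_system T) (FF : Filter F) (f : T -> K)
    (g : T -> Y) (a : K) (b : Y) :
  (f : T -> K^o) @ F --> (a : K^o) -> g @ F --> b ->
  (fun t => f t *: g t) @ F --> a *: b.
Proof.
move=> fa gb.
apply: (@cvg_comp _ _ _ (fun t => (f t, g t)) (fun p : K^o * Y => p.1 *: p.2)
  F (nbhs ((a : K^o), b)) (nbhs (a *: b))).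
  exact: (@cvg_pair _ _ _ _ (nbhs (a : K^o)) (nbhs b) _ _ _ f g fa gb).
exact: (@scale_continuous K Y (a, b)).
Qed.

(** The contraction property is convexity along segments ending at 0. *)
Lemma convex_nbhs0 (v : Y) : v <> 0 -> exists b : set Y,
  [/\ open b, b 0, ~ b v &
      forall (w : Y) (c : K), 0 <= c <= 1 -> b w -> b (c *: w)].
Proof.
move=> v0; have [B Bconv [oB Bbase]] := @locally_convex K Y.
have U0 : nbhs (0 : Y) [set~ v].
  apply: open_nbhs_nbhs; split; last by move=> /esym.
  apply: closed_openC.
  exact: (@accessible_closed_set1 _ (hausdorff_accessible hausY)).
have [b [Bb b0] bU] := Bbase 0 _ U0.
exists b; split=> //; [exact: oB|by move=> /bU; apply|].
move=> w c /andP[c0 c1] bw.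
have := Bconv b (mem_set Bb) w 0 (Itv01 c0 c1) (mem_set bw) (mem_set b0).
by rewrite inE /conv /= scaler0 addr0.
Qed.

(** The dilations of a star-shaped open neighborhood of 0 missing v. *)
Lemma dilation_exhaustion (v : Y) : v <> 0 -> exists V : nat -> set Y,
  [/\ forall n, open (V n),
      forall n m, (n <= m)%N -> V n `<=` V m,
      forall z, exists n, V n z,
      forall n, V n 0 &
      forall n, ~ V n (n.+1%:R *: v)].
Proof.
move=> /convex_nbhs0[b [ob b0 nbv bstar]].
exists (fun n => [set z | b (n.+1%:R^-1 *: z)]).
split=> [n|n m nm z /= bz|z|n|n] /=.
- apply: (@open_comp _ _ ( *:%R n.+1%:R^-1) b) => // z _.
  by apply: scale_cvg; [exact: cvg_cst|exact: cvg_id].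
- have -> : m.+1%:R^-1 *: z = (n.+1%:R / m.+1%:R) *: (n.+1%:R^-1 *: z).
    by rewrite scalerA mulrAC mulfV ?pnatr_eq0// mul1r.
  apply: bstar => //; rewrite divr_ge0//= ler_pdivrMr ?ltr0n// mul1r.
  by rewrite ler_nat.
- have : (fun n => (n.+1%:R^-1 : K) *: z) @ \oo --> (0 : K) *: z.
    apply: scale_cvg; last exact: cvg_cst.
    under eq_fun do rewrite -phiV.
    rewrite -phi0; apply: (@cvg_comp _ _ _ (fun n => n.+1%:R^-1 : R) phi).
      exact: cvg_harmonic.
    exact: cphi.
  rewrite scale0r => /(_ b (open_nbhs_nbhs (conj ob b0)))[m _ mb].
  by exists m; exact: (mb m (leqnn m)).
- by rewrite scaler0.
- by rewrite scalerA mulVf ?pnatr_eq0// scale1r.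
Qed.

(** The segment from 0 to v.  A function with values in it is both bounded and
    of relatively compact range, so one bump function serves all three
    spaces. *)
Definition segment0 (v : Y) : set Y := (fun t => phi t *: v) @` `[0, 1]%classic.

Lemma compact_segment0 v : compact (segment0 v).
Proof.
apply: continuous_compact; last exact: segment_compact.
apply: continuous_subspaceT => t; apply: scale_cvg; last exact: cvg_cst.
exact: cphi.
Qed.

Lemma compact_closure_sub_segment0 v (B : set Y) :
  B `<=` segment0 v -> compact (closure B).
Proof.
move=> Bv; apply: (subclosed_compact _ (@compact_segment0 v)).
  exact: closed_closure.
have /closure_id -> : closed (segment0 v).
  by apply: compact_closed => //; exact: compact_segment0.
exact: closure_subset.
Qed.

Lemma bounded_sub_segment0 v (B : set Y) : B `<=` segment0 v -> tvs_bounded B.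
Proof.
move=> Bv U U0.
have := @scale_continuous K Y (0, v); rewrite /continuous_at /= scale0r.
move=> /(_ U U0)[[N M] /= [N0 Mv] NMU].
have [e /= e0 eN] := N0.
exists e^-1 => [|t et w /Bv[s s01 <-]]; first by rewrite invr_gt0.
have t0 : 0 < t by apply: lt_trans et; rewrite invr_gt0.
exists (t^-1 *: (phi s *: v)); last by rewrite scalerA mulfV ?scale1r// gt_eqF.
rewrite scalerA; apply: (NMU (t^-1 * phi s, v)); split=> /=.
  apply: eN; rewrite /= sub0r normrN normrM.
  have : `|t^-1| < e.
    by rewrite gtr0_norm ?invr_gt0// -[e]invrK ltf_pV2 ?posrE ?invr_gt0.
  apply: le_lt_trans; rewrite ler_piMr//; apply: phi01.
  by move: s01; rewrite /= in_itv.
exact: nbhs_singleton.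
Qed.

End locally_convex_space.

Lemma bump_function (R : realType) (K : numFieldType) (X : topologicalType)
    (I : set (set X)) (Y : tvsType K) (phi : R -> K) (A U : set X) (v : Y) :
  continuous (phi : R -> K^o) -> phi 0 = 0 -> phi 1 = 1 ->
  completely_regular_space X -> compact A -> open U -> A `<=` U ->
  exists f : ideal_open X Y I,
    [/\ forall x, A x -> ev f x = 0, forall x, ~ U x -> ev f x = v
      & range (ev f) `<=` segment0 phi v].
Proof.
move=> cphi phi0 phi1 crX cA oU AU.
have [h [ch h01 hA hU]] := @compact_closed_separation R X A U crX cA oU AU.
have cf : continuous (fun x => phi (h x) *: v : Y).
  move=> x; apply: (@scale_cvg K Y X (nbhs x) _ (phi \o h) (fun=> v)).
    by apply: continuous_comp; [exact: ch|exact: cphi].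
  exact: cvg_cst.
exists (mkcts cf : continuousType X Y); split=> [x Ax|x nUx|_ [x _ <-]].
- by rewrite /ev /= /mkcts hA// phi0 scale0r.
- by rewrite /ev /= /mkcts hU// phi1 scale1r.
- by exists (h x) => //=; rewrite in_itv /=; exact: h01.
Qed.

(** * Powers of a function space and the equivalences *)

(** The diagonal is a continuous section of each projection. *)
Lemma ptws_retract (J : eqType) (i0 : J) (E : topologicalType) :
  exists (p : {ptws J -> E} -> E) (s : E -> {ptws J -> E}),
    [/\ continuous p, continuous s & cancel s p].
Proof.
exists (fun f => f i0), (fun f => fun=> f); split=> //.
  exact: (@proj_continuous J (fun=> E) i0).
move=> f; apply: ptws_cvgP => i; exact: cvg_id.
Qed.

Lemma power_retract (E : topologicalType) lam : lam <> Some 0%N ->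
  exists (p : power_space E lam -> E) (s : E -> power_space E lam),
    [/\ continuous p, continuous s & cancel s p].
Proof.
case: lam => [[|n]|] //= _; first exact: (@ptws_retract 'I_n.+1 ord0).
exact: (@ptws_retract nat 0%N).
Qed.

Lemma sequentiality_equivalences (E : topologicalType) (gam : Prop) :
  (k_space E -> gam) ->
  (forall (J : eqType) (c : J -> nat), injective c -> gam ->
     frechet_urysohn {ptws J -> E}) ->
  [<-> frechet_urysohn E; sequential_space E; k_space E; gam;
       exists2 lam : exponent, lam <> Some 0%N &
         frechet_urysohn (power_space E lam);
       exists2 lam : exponent, lam <> Some 0%N &
         sequential_space (power_space E lam);
       exists2 lam : exponent, lam <> Some 0%N & k_space (power_space E lam);
       forall lam : exponent, lam <> Some 0%N ->
         frechet_urysohn (power_space E lam);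
       forall lam : exponent, lam <> Some 0%N ->
         sequential_space (power_space E lam);
       forall lam : exponent, lam <> Some 0%N -> k_space (power_space E lam)].
Proof.
move=> kgam gamFU.
have powFU lam : gam -> frechet_urysohn (power_space E lam).
  case: lam => [n|]; first exact: (gamFU 'I_n (@nat_of_ord n) (@ord_inj n)).
  exact: (gamFU nat id (@inj_id _)).
have kpow lam : lam <> Some 0%N -> k_space (power_space E lam) -> k_space E.
  move=> /(power_retract E)[p [s [cp cs ps]]].
  exact: (retract_k_space cp cs ps).
have one : Some 1%N <> Some 0%N by [].
tfae.
- exact: frechet_urysohn_sequential.
- exact: sequential_k_space.
- exact: kgam.
- by move=> /(powFU (Some 1%N)); exists (Some 1%N).
- by move=> [lam lam0 FU]; exists lam => //; exact: frechet_urysohn_sequential.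
- by move=> [lam lam0 sq]; exists lam => //; exact: sequential_k_space.
- by move=> [lam lam0 /(kpow _ lam0)/kgam h] lam' _; exact: powFU.
- by move=> FU lam lam0; apply: frechet_urysohn_sequential; exact: FU.
- by move=> sq lam lam0; apply: sequential_k_space; exact: sq.
- move=> /(_ _ one)/(kpow _ one)/kgam/(powFU (Some 1%N)).
  have [p [s [cp cs ps]]] := power_retract E one.
  exact: (retract_frechet_urysohn cp cs ps).
Qed.

Local Open Scope complex_scope.

Theorem theorem4p5 (R : realType) (K : numFieldType)
    (hK : K = (R : numFieldType) \/ K = (R[i] : numFieldType))
    (X : topologicalType) (hX : tychonoff_space X)
    (I : set (set X)) (hI : compact_ideal I)
    (Y : tvsType K) (hYm : metrizable Y R) (hY : exists y : Y, y <> 0)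
    (E : topologicalType)
    (hE : [\/ E = C_ I Y, E = Cb I Y | E = Crc I Y]) :
  [<-> (* i *)   frechet_urysohn E;
       (* ii *)  sequential_space E;
       (* iii *) k_space E;
       (* iv *)  gamma_property I;
       (* v *)   exists2 lam : exponent, lam <> Some 0%N &
                   frechet_urysohn (power_space E lam);
                 exists2 lam : exponent, lam <> Some 0%N &
                   sequential_space (power_space E lam);
                 exists2 lam : exponent, lam <> Some 0%N &
                   k_space (power_space E lam);
       (* vi *)  forall lam : exponent, lam <> Some 0%N ->
                   frechet_urysohn (power_space E lam);
                 forall lam : exponent, lam <> Some 0%N ->
                   sequential_space (power_space E lam);
                 forall lam : exponent, lam <> Some 0%N ->
                   k_space (power_space E lam) ].
Proof.
have [d md] := hYm; have [v v0] := hY; have [crX hausX] := hX.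
have hausY : hausdorff_space Y by exact: (@metric_of_hausdorff R Y d).
have [phi [cphi phi0 phi1 phiV phi01]] := real_scalars hK.
have [V [oV Vmono Vcover V0 Vv]] := dilation_exhaustion cphi phi0 phiV hausY v0.
have bump A U w : I A -> open U -> A `<=` U -> exists f : C_ I Y,
    [/\ forall x, A x -> ev f x = 0, forall x, ~ U x -> ev f x = w
      & range (ev f) `<=` segment0 phi w].
  by move=> IA; apply: bump_function => //; case: hI => _ + _ _ _; apply.
have T1 (x : X) : closed [set x].
  exact: (@accessible_closed_set1 _ (hausdorff_accessible hausX)).
have [E_ev [uE bE]] : exists E_ev : E -> X -> Y, ideal_uniform I d E_ev /\
    forall A U w, I A -> open U -> A `<=` U -> exists f : E,
      (forall x, A x -> E_ev f x = 0) /\ (forall x, ~ U x -> E_ev f x = w).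
  case: hE => ->.
  - exists (@ev X Y I); split; first exact: ideal_open_uniform.
    move=> A U w IA oU AU; have [f [fA fU _]] := bump A U w IA oU AU.
    by exists f.
  - exists (fun f => ev (set_val f)); split; first exact: subspace_uniform.
    move=> A U w IA oU AU; have [f [fA fU fw]] := bump A U w IA oU AU.
    have Pf : [set f : C_ I Y | tvs_bounded (range (f : continuousType X Y))] f.
      exact: bounded_sub_segment0 fw.
    by exists (exist _ f (mem_set Pf)).
  - exists (fun f => ev (set_val f)); split; first exact: subspace_uniform.
    move=> A U w IA oU AU; have [f [fA fU fw]] := bump A U w IA oU AU.
    have Pf : [set f : C_ I Y |
        compact (closure (range (f : continuousType X Y)))] f.
      exact: compact_closure_sub_segment0 fw.
    by exists (exist _ f (mem_set Pf)).
apply: sequentiality_equivalences.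
  by apply: (k_space_gamma_property hI md uE oV Vmono Vcover V0 Vv bE).
by move=> J c; exact: (gamma_frechet_urysohn_ptws hI md uE T1).
Qed.
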